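(* Let $G$ be a connected graph and let $k$ be an integer with $\chi(G) \leq k \leq \Sigma(G)$. Then there is a folding of $G$ onto the complete graph $K_k$.
   Context: Graphs are finite, undirected, without loops or multiple edges. $\chi(G)$ denotes the chromatic number of $G$. Simple fold: if $x$ and $y$ are two vertices of a graph $G$ at distance exactly two in $G$, the simple fold with respect to $x$ and $y$ is the operation that identifies $x$ and $y$ into a single vertex (adjacent to every vertex that was adjacent to $x$ or to $y$); multiple edges that arise are identified into a single edge. A folding of $G$ onto a graph $H$ is a finite (possibly empty) sequence of simple folds, each applied to the graph resulting from the previous ones, starting at $G$ and ending at a graph isomorphic to $H$; if one exists, $G$ is said to fold onto $H$. For a connected graph $G$, any maximal sequence of simple folds ends in a complete graph (clique), and $\Sigma(G)$ denotes the number of vertices of the largest clique onto which $G$ folds. *)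

(* Defs.v *)
From mathcomp Require Import all_boot.
From mathcomp Require Import boolp.
Set Implicit Arguments.
Unset Strict Implicit.
Unset Printing Implicit Defensive.

Record sgraph := SGraph {
  vertex :> finType;
  adj : rel vertex;
  adj_sym : symmetric adj;
  adj_irrefl : irreflexive adj }.

(* The empty graph is not excluded: it counts as connected. *)
Definition connected (G : sgraph) : bool :=
  [forall x : G, forall y : G, connect (@adj G) x y].

Definition colorable (G : sgraph) (k : nat) : bool :=
  [exists f : {ffun G -> 'I_k},
    [forall u : G, forall v : G, adj u v ==> (f u != f v)]].

Lemma colorable_card (G : sgraph) : colorable G #|G|.
Proof.
apply/existsP; exists [ffun u => enum_rank u].
apply/forallP => u; apply/forallP => v; apply/implyP => uv.
rewrite !ffunE (inj_eq enum_rank_inj).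
by apply: contraTneq uv => ->; rewrite adj_irrefl.
Qed.

Definition chi (G : sgraph) : nat :=
  ex_minn (ex_intro (colorable G) #|G| (colorable_card G)).

Definition walk (G : sgraph) (n : nat) (x y : G) : bool :=
  [exists p : n.-tuple G, path (@adj G) x p && (last x p == y)].

Definition at_dist (G : sgraph) (d : nat) (x y : G) : bool :=
  walk d x y && [forall m : 'I_d, ~~ walk m x y].

Lemma at_dist2 (G : sgraph) (x y : G) :
  at_dist 2 x y = [&& x != y, ~~ adj x y & [exists z, adj x z && adj z y]].
Proof.
have w0 : walk 0 x y = (x == y).
  apply/existsP/eqP => [[p]|->]; last by exists [tuple]; rewrite /= eqxx.
  by rewrite tuple0 /= => /eqP.
have w1 : walk 1 x y = adj x y.
  apply/existsP/idP => [[[[|a [|? ?]] //= _]]|xy].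
    by rewrite andbT => /andP[xa /eqP <-].
  by exists [tuple y]; rewrite /= xy eqxx.
have w2 : walk 2 x y = [exists z, adj x z && adj z y].
  apply/existsP/existsP => [[[[|a [|b [|? ?]]] //= _]]|[z /andP[xz zy]]].
    by rewrite andbT => /andP[/andP[xa ab] /eqP <-]; exists a; rewrite xa.
  by exists [tuple z; y]; rewrite /= xz zy eqxx.
rewrite /at_dist w2 andbC andbA; congr (_ && _).
apply/forallP/andP => [h|[n0 n1] [[|[|m]] //= _]].
- by have := h ord0; have := h ord_max; rewrite /= w0 w1.
- by rewrite w0.
- by rewrite w1.
Qed.

Section SimpleFold.
Variables (G : sgraph) (x y : G).

(* The fold lives on G minus [y]; there, [x] stands for the merged vertex
   {x, y}, which inherits the neighbours of both. *)
Definition fold_adj : rel {z : G | z != y} := fun a b =>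
  [|| adj (val a) (val b),
      (val a == x) && adj y (val b) |
      (val b == x) && adj y (val a)].

Lemma fold_adj_sym : symmetric fold_adj.
Proof. by move=> a b; rewrite /fold_adj adj_sym; congr (_ || _); rewrite orbC. Qed.

Hypothesis xy2 : at_dist 2 x y.

Lemma fold_adj_irrefl : irreflexive fold_adj.
Proof.
move=> a; rewrite /fold_adj adj_irrefl orbb /=.
case: eqP => //= ->; rewrite adj_sym.
by move: xy2; rewrite at_dist2 => /and3P[_ /negbTE].
Qed.

Definition simple_fold : sgraph := SGraph fold_adj_sym fold_adj_irrefl.

End SimpleFold.

Definition isomorphic (G H : sgraph) : Prop :=
  exists f : G -> H, bijective f /\ forall u v, adj (f u) (f v) = adj u v.

Inductive folds_onto (G H : sgraph) : Prop :=
| folds_iso of isomorphic G H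
| folds_step (x y : G) (xy2 : at_dist 2 x y) of folds_onto (simple_fold xy2) H.

Section Complete.
Variable n : nat.

Definition complete_adj : rel 'I_n := fun i j => i != j.

Lemma complete_adj_sym : symmetric complete_adj.
Proof. by move=> i j; rewrite /complete_adj eq_sym. Qed.

Lemma complete_adj_irrefl : irreflexive complete_adj.
Proof. by move=> i; rewrite /complete_adj eqxx. Qed.

Definition complete : sgraph := SGraph complete_adj_sym complete_adj_irrefl.

End Complete.

(* Bounding [n] by the order of [G] loses nothing, as folds do not create
   vertices: see [leq_Sigma]. *)
Definition Sigma (G : sgraph) : nat :=
  \max_(n < #|G|.+1 | `[< folds_onto G (complete n) >]) n.

Lemma folds_card (G H : sgraph) : folds_onto G H -> #|H| <= #|G|.
Proof.
elim=> {G H} G H; first by case=> f [/bij_eq_card -> _].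
move=> x y xy2 _ /leq_trans -> //.
by rewrite card_sig max_card.
Qed.

Lemma leq_Sigma (G : sgraph) (n : nat) :
  folds_onto G (complete n) -> n <= Sigma G.
Proof.
move=> Gn; have := folds_card Gn; rewrite card_ord -ltnS => ltn.
exact: (@leq_bigmax_cond _ _ (fun i : 'I_#|G|.+1 => val i) (Ordinal ltn) (asboolT Gn)).
Qed.

Lemma connected_fold (G : sgraph) (x y : G) (xy2 : at_dist 2 x y) :
  connected G -> connected (simple_fold xy2).
Proof.
move=> cG; have xy : x != y by move: xy2; rewrite at_dist2 => /and3P[].
pose g z : simple_fold xy2 := insubd (exist (fun z => z != y) x xy) z.
have gE (z : G) : val (g z) = if z == y then x else z.
  by rewrite val_insubd /=; case: eqP.
have gadj u v : adj u v -> connect (@adj (simple_fold xy2)) (g u) (g v).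
  move=> uv; apply: connect1; rewrite /= /fold_adj !gE.
  case: (eqVneq u y) uv => [->|_]; case: (eqVneq v y) => [->|_] uv.
  - by rewrite adj_irrefl in uv.
  - by rewrite eqxx uv orbT.
  - by rewrite eqxx adj_sym [adj y u]adj_sym uv !orbT.
  - by rewrite uv.
have gconn u p : path (@adj G) u p ->
    connect (@adj (simple_fold xy2)) (g u) (g (last u p)).
  elim: p u => [|v p IH] u //= /andP[uv /IH].
  exact/connect_trans/gadj.
have gval a : g (val a) = a by apply: val_inj; rewrite gE (negbTE (valP a)).
apply/forallP => a; apply/forallP => b.
have /connectP[p ap lp] := forallP (forallP cG (val a)) (val b).
by rewrite -[a]gval -[b]gval lp; apply: gconn.
Qed.

Lemma folds_complete (G : sgraph) :
  connected G -> exists n, folds_onto G (complete n).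
Proof.
have [m] := ubnP #|G|; elim: m G => // m IH G ltGm cG.
have [/existsP[x /existsP[y xy2]]|no2] :=
    boolP [exists x : G, exists y : G, at_dist 2 x y].
  have [||n Hn] := IH (simple_fold xy2); last by exists n; apply: folds_step Hn.
    rewrite -ltnS (leq_trans _ ltGm) // ltnS card_sig.
    by rewrite -(cardC (pred1 y)) card1 add1n ltnS; apply: subset_leq_card; apply/subsetP.
  exact: connected_fold.
exists #|G|; apply: folds_iso; exists enum_rank; split; first exact: enum_rank_bij.
have conn_adj (u v : G) : connect (@adj G) u v -> (u == v) || adj u v.
  case/connectP=> p; elim/last_ind: p v => [|p w IHp] v /=; first by move=> _ ->; rewrite eqxx.
  rewrite rcons_path last_rcons => /andP[up lw] ->.
  have /orP[/eqP ->|ul] := IHp _ up erefl; first by rewrite lw orbT.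
  apply: contraNT no2; rewrite negb_or => /andP[uw nuw].
  apply/existsP; exists u; apply/existsP; exists w; rewrite at_dist2 uw nuw.
  by apply/existsP; exists (last u p); rewrite ul.
move=> u v; rewrite /= /complete_adj (inj_eq enum_rank_inj).
have := conn_adj _ _ (forallP (forallP cG u) v).
by case: eqP => [->|] //=; rewrite adj_irrefl.
Qed.

Lemma Sigma_folds (G : sgraph) :
  connected G -> folds_onto G (complete (Sigma G)).
Proof.
move=> /folds_complete[n Gn]; have := folds_card Gn.
rewrite card_ord -ltnS => ltn; rewrite /Sigma.
rewrite (@bigmax_eq_arg _ (Ordinal ltn)); last exact: asboolT.
by case: arg_maxnP => [|i /asboolP]; first exact: asboolT.
Qed.

(* Main.v *)
Require Import Defs.
From mathcomp Require Import all_boot.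

Set Implicit Arguments.
Unset Strict Implicit.
Unset Printing Implicit Defensive.

(** A fold identifies two non-adjacent vertices [x] and [y], so it raises the
    chromatic number by at most one: give [x] and [y] a common fresh colour
    ([colorable_foldS]).  Hence along a folding of [G] onto the largest clique
    the chromatic number climbs from [chi G] to [Sigma G] without skipping a
    value, and for each [k] in between some intermediate graph has chromatic
    number exactly [k].

    It remains to fold a connected graph onto the clique whose order is its
    chromatic number.  For this, a [k]-colourable connected graph that is not
    complete always admits a fold preserving [k]-colourability
    ([colorable_fold_exists]): either two vertices at distance two share a
    colour, or the neighbours of each vertex have distinct colours, and then a Kempe
    exchange at one of two vertices at distance two, on a chain of at most one
    edge, makes them agree.  Repeating this
    ends in a [k]-colourable clique ([colorable_folds_complete]), whose order
    cannot drop below the chromatic number since folding is a homomorphism. *)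

Lemma colorableP (G : sgraph) (k : nat) :
  reflect (exists c : G -> 'I_k, forall u v, adj u v -> c u != c v)
          (colorable G k).
Proof.
apply: (iffP existsP) => [[f /forallP cf]|[c cP]].
  by exists f => u v uv; have /forallP/(_ v)/implyP := cf u; apply.
exists [ffun u => c u]; apply/forallP => u; apply/forallP => v.
by apply/implyP => uv; rewrite !ffunE cP.
Qed.

Lemma colorable_hom (G H : sgraph) (f : G -> H) (k : nat) :
  (forall u v, adj u v -> adj (f u) (f v)) -> colorable H k -> colorable G k.
Proof.
move=> fhom /colorableP[c cP]; apply/colorableP.
by exists (c \o f) => u v /fhom /cP.
Qed.

Lemma leq_colorable (G : sgraph) (j k : nat) :
  j <= k -> colorable G j -> colorable G k.
Proof.
move=> lejk /colorableP[c cP]; apply/colorableP.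
by exists (widen_ord lejk \o c) => u v /cP.
Qed.

Lemma chi_colorable (G : sgraph) : colorable G (chi G).
Proof. by rewrite /chi; case: ex_minnP. Qed.

Lemma colorable_complete (n k : nat) : colorable (complete n) k = (n <= k).
Proof.
apply/idP/idP => [/colorableP[c cP]|le_nk]; last first.
  by apply: leq_colorable le_nk _; apply/colorableP; exists id.
have c_inj : injective c.
  by move=> i j /eqP cij; apply: contraTeq cij => /cP.
by have := leq_card c c_inj; rewrite !card_ord.
Qed.

Lemma isomorphic_colorable (G H : sgraph) (k : nat) :
  isomorphic G H -> colorable G k = colorable H k.
Proof.
move=> [f [[g fK gK] fadj]]; apply/idP/idP.
  by apply: (colorable_hom (f := g)) => u v; rewrite -fadj !gK.
by apply: (colorable_hom (f := f)) => u v; rewrite fadj.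
Qed.

Lemma at_dist2_neq (G : sgraph) (x y : G) : at_dist 2 x y -> x != y.
Proof. by rewrite at_dist2 => /and3P[]. Qed.

Lemma fold_colorable (G : sgraph) (x y : G) (xy2 : at_dist 2 x y) (k : nat) :
  colorable (simple_fold xy2) k -> colorable G k.
Proof.
have xy := at_dist2_neq xy2.
pose q z : simple_fold xy2 := insubd (exist (fun z => z != y) x xy) z.
have qE (z : G) : val (q z) = if z == y then x else z.
  by rewrite val_insubd; case: eqP.
apply: (colorable_hom (f := q)) => u v; rewrite /= /fold_adj !qE.
case: (eqVneq u y) => [->|_]; case: (eqVneq v y) => [->|_] uv.
- by rewrite adj_irrefl in uv.
- by rewrite eqxx uv orbT.
- by rewrite eqxx adj_sym [adj y u]adj_sym uv !orbT.
- by rewrite uv.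
Qed.

Lemma folds_colorable (G H : sgraph) (k : nat) :
  folds_onto G H -> colorable H k -> colorable G k.
Proof.
elim=> {G H} [G H /isomorphic_colorable -> //|G H x y xy2 _ IH /IH].
exact: fold_colorable.
Qed.

Lemma colorable_fold (G : sgraph) (x y : G) (xy2 : at_dist 2 x y) (k : nat)
    (c : G -> 'I_k) :
  (forall u v, adj u v -> c u != c v) -> c x = c y ->
  colorable (simple_fold xy2) k.
Proof.
move=> cP cxy; apply/colorableP; exists (c \o val) => a b /=.
case/or3P => [/cP //|/andP[/eqP -> /cP]|/andP[/eqP -> /cP]]; rewrite cxy //.
by rewrite eq_sym.
Qed.

Lemma colorable_foldS (G : sgraph) (x y : G) (xy2 : at_dist 2 x y) (k : nat) :
  colorable G k -> colorable (simple_fold xy2) k.+1.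
Proof.
move=> /colorableP[c cP].
have /and3P[_ nxy _] : [&& x != y, ~~ adj x y & [exists z, adj x z && adj z y]].
  by rewrite -at_dist2.
pose c' u := if u \in pred2 x y then ord_max else widen_ord (leqnSn k) (c u).
apply: (colorable_fold xy2 (c := c')); last by rewrite /c' !inE !eqxx orbT.
have c_max u : widen_ord (leqnSn k) (c u) != ord_max.
  by rewrite -val_eqE /= ltn_eqF.
move=> u v uv; rewrite /c'.
case: ifP => ux; case: ifP => vx //; last exact: cP.
  have yx : adj y x = false by rewrite adj_sym (negbTE nxy).
  move: ux vx uv => /pred2P[] -> /pred2P[] ->;
  by rewrite ?adj_irrefl ?yx ?(negbTE nxy).
by rewrite eq_sym.
Qed.

(** If no two vertices at distance two share a colour, every vertex has at most
    one neighbour of each colour, so each two-coloured Kempe chain is a vertex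
    or an edge.  For [x], [y] at distance two, exchanging the colours [c x] and
    [c y] on the chain of [y] thus leaves [x] alone and gives [y] the colour of
    [x]. *)
Lemma colorable_fold_exists (G : sgraph) (x y : G) (k : nat) :
  at_dist 2 x y -> colorable G k ->
  exists (u v : G) (uv2 : at_dist 2 u v), colorable (simple_fold uv2) k.
Proof.
move=> xy2 /colorableP[c cP].
have [/existsP[u /existsP[v /andP[uv2 /eqP cuv]]]|rainbow] :=
    boolP [exists u : G, exists v : G, at_dist 2 u v && (c u == c v)].
  by exists u, v, uv2; exact: (colorable_fold uv2 cP cuv).
have nbr_inj z u v : adj z u -> adj z v -> c u = c v -> u = v.
  move=> zu zv cuv; apply: contraNeq rainbow => neq_uv.
  apply/existsP; exists u; apply/existsP; exists v; rewrite cuv eqxx andbT.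
  rewrite at_dist2 neq_uv /=; apply/andP; split.
    by apply/negP => /cP; rewrite cuv eqxx.
  by apply/existsP; exists z; rewrite adj_sym zu.
exists x, y, xy2.
have /and3P[neq_xy nxy _] :
    [&& x != y, ~~ adj x y & [exists z, adj x z && adj z y]].
  by rewrite -at_dist2.
pose c' u := if u == y then c x
             else if adj y u && (c u == c x) then c y else c u.
apply: (colorable_fold xy2 (c := c')); last first.
  by rewrite /c' !eqxx (negbTE neq_xy) adj_sym (negbTE nxy).
have c'y v : adj y v -> c' y != c' v.
  move=> yv; have vy : v != y by apply: contraTneq yv => ->; rewrite adj_irrefl.
  rewrite /c' eqxx (negbTE vy) yv /=.
  by case: ifP => [/eqP <-|/negbT]; rewrite eq_sym // cP.
(* The partner of [y] in the exchange takes colour [c y], which the partner's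
   other neighbours avoid: [y] is its only neighbour with that colour. *)
have c'_partner u v : adj u v -> v != y -> adj y u -> c u = c x -> c y != c' v.
  move=> uv vy yu cu; rewrite /c' (negbTE vy); case: ifP => [/andP[_ /eqP cv]|_].
    by have := cP u v uv; rewrite cu cv eqxx.
  apply: contra_neq vy => cyv; apply: (nbr_inj u) => //.
  by rewrite adj_sym.
move=> u v; have [->|uy] := eqVneq u y; first exact: c'y.
have [->|vy uv] := eqVneq v y; first by rewrite adj_sym eq_sym; apply: c'y.
have [/andP[yu /eqP cu]|nu] := boolP (adj y u && (c u == c x)).
  by rewrite [c' u]/c' (negbTE uy) yu cu eqxx; apply: c'_partner uv vy yu cu.
have [/andP[yv /eqP cv]|nv] := boolP (adj y v && (c v == c x)).
  rewrite eq_sym [c' v]/c' (negbTE vy) yv cv eqxx.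
  by apply: c'_partner uy yv cv; rewrite adj_sym.
by rewrite /c' (negbTE uy) (negbTE vy) (negbTE nu) (negbTE nv) cP.
Qed.

Lemma card_fold (G : sgraph) (x y : G) (xy2 : at_dist 2 x y) :
  #|simple_fold xy2| < #|G|.
Proof.
rewrite card_sig -(cardC (pred1 y)) card1 add1n ltnS.
exact/subset_leq_card/subsetP.
Qed.

Lemma colorable_folds_complete (G : sgraph) (k : nat) :
  connected G -> colorable G k ->
  exists2 j, j <= k & folds_onto G (complete j).
Proof.
have [m] := ubnP #|G|; elim: m G => // m IH G ltGm cG colG.
(* Any folding of [G] onto a clique tells whether [G] is already complete or
   has two vertices at distance two. *)
have [n] := folds_complete cG; case=> [iso|x y xy2 _].
  exists n; last exact: folds_iso.
  by rewrite -colorable_complete -(isomorphic_colorable _ iso).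
have [u [v [uv2 colF]]] := colorable_fold_exists xy2 colG.
have [||//|j le_jk Fj] := IH (simple_fold uv2).
- exact: leq_trans (card_fold uv2) _.
- exact: connected_fold.
- by exists j => //; apply: folds_step Fj.
Qed.

(** Follow the folding onto [complete n] as long as the graph stays
    [k]-colourable.  Just before the step that breaks this, the chromatic number
    is exactly [k], since one fold adds at most one colour; from there on, fold
    onto a [k]-colourable clique instead. *)
Lemma folds_complete_interpolation (G : sgraph) (n k : nat) :
  folds_onto G (complete n) -> connected G -> colorable G k -> k <= n ->
  folds_onto G (complete k).
Proof.
move=> + + + le_kn; move defH: (complete n) => H GH.
elim: GH defH => {G H} [G H iso|G H x y xy2 _ IH] defH cG colG.
  have le_nk : n <= k.
    by rewrite -colorable_complete defH -(isomorphic_colorable _ iso).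
  have -> : k = n by apply/eqP; rewrite eqn_leq le_kn.
  by rewrite defH; apply: folds_iso.
have [colF|ncolF] := boolP (colorable (simple_fold xy2) k).
  by apply: folds_step (IH defH _ colF); apply: connected_fold.
have [j le_jk Gj] := colorable_folds_complete cG colG.
suff /eqP <- : j == k by [].
rewrite eqn_leq le_jk leqNgt; apply: contra ncolF => lt_jk.
apply: leq_colorable lt_jk (colorable_foldS xy2 _).
by apply: folds_colorable Gj _; rewrite colorable_complete.
Qed.

Theorem theorem1 (G : sgraph) (k : nat) :
  connected G -> chi G <= k <= Sigma G -> folds_onto G (complete k).
Proof.
move=> cG /andP[le_chi le_Sigma].
apply: folds_complete_interpolation (Sigma_folds cG) cG _ le_Sigma.
exact: leq_colorable le_chi (chi_colorable G).
Qed.
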